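(* Let $G_N(x,y,p,q)=\sum_{\pi\in\mathcal D,\ h(\pi)\le N}x^{n(\pi)}y^{h(\pi)}p^{w(\pi)}q^{a(\pi)}$ for $N\ge0$. For $q\neq0$ (that is, as an identity of formal power series in $x$ over a coefficient ring in which $q$ is invertible), $$G_N(x,y,p,q)=\sum_{h=0}^{N}\frac{x^hy^hq^{h^2}\displaystyle\prod_{k=1}^{h}\frac{P_k(q^{2k-3}p^3x,\,p^2/q^2)^2}{P_k(q^{2k-3}px,\,p^2/q^2)^2}}{P_h(q^{2h-3}p^3x,\,p^2/q^2)\;P_{h+1}(q^{2h-1}px,\,p^2/q^2)},$$ where empty products are $1$. On the boundary $q=0$ one has $G_N(x,y,p,0)=1$, and at $p=0$ one has $G_N(x,y,0,q)=1+\sum_{h=1}^{N}(xy)^hq^{h^2}$. The unbounded-height generating function $G(x,y,p,q)=\sum_{\pi\in\mathcal D}x^{n(\pi)}y^{h(\pi)}p^{w(\pi)}q^{a(\pi)}$ is the formal (coefficientwise in $x$) limit of $G_N$ as $N\to\infty$.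
   Context: A Dyck path is a lattice path starting at $(0,0)$, with steps $U=(1,1)$ and $D=(1,-1)$, ending on the line $y=0$ and never visiting a vertex with negative $y$-coordinate; $\mathcal D$ is the set of all Dyck paths (including the empty path). For $\pi\in\mathcal D$ with $2n$ steps, $n(\pi)=n$ is the semi-length; the height $h(\pi)$ is the maximum $y$-coordinate; the proper area $a(\pi)$ is the sum of the starting heights of all steps. Water capacity $w(\pi)$: let $h=h(\pi)$. For each $1\le k\le h$ mark the first up-step $U_k$ of $\pi$ from level $k-1$ to $k$ and the last down-step $D_k$ from level $k$ to $k-1$; they occur in the order $U_1,\dots,U_h,D_h,\dots,D_1$. The portions of $\pi$ strictly between consecutive marked steps are the gaps: for $1\le k<h$ a left gap at level $k$ (between $U_k$ and $U_{k+1}$) and a right gap at level $k$ (between $D_{k+1}$ and $D_k$), and a single top gap at level $h$ (between $U_h$ and $D_h$). A gap at level $k$ starts and ends at height $k$ and never rises above height $k$; reflecting it in the line $y=k$ and translating to the horizontal axis gives a Dyck path of height at most $k$. Then $w(\pi)$ is the sum over all gaps of the proper areas of these reflected Dyck paths (and $w=0$ for the empty path). For $h\ge0$, $P_h(X,Q)=\sum_{m=0}^{\lfloor h/2\rfloor}(-X)^mQ^{m(m-1)}\begin{bmatrix} h-m \\ m \end{bmatrix}_Q$, where $\begin{bmatrix} N \\ m \end{bmatrix}_Q$ is the Gaussian binomial polynomial in $Q$. In particular $P_0=P_1=1$, so the arguments of $P_0,P_1$ are immaterial; each $P_h$ has constant term $1$ in $X$, so the quotients are expanded as formal power series in $x$.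 *)

(* Defs.v *)
From HB Require Import structures.
From mathcomp Require Import all_boot all_order all_algebra.
From mathcomp Require boolp.

Set Implicit Arguments.
Unset Strict Implicit.
Unset Printing Implicit Defensive.

Import GRing.Theory.
Local Open Scope ring_scope.

(** * Formal power series in one variable *)

(* A record rather than a bare function type: [nat -> R] may carry the
   pointwise ring structure, which is not the one wanted here. *)
Record fps (R : Type) := FPS { fpscoef : nat -> R }.

Lemma fpsP (R : Type) (f g : fps R) : fpscoef f =1 fpscoef g -> f = g.
Proof. by case: f g => [f] [g] /= /boolp.funext ->. Qed.

HB.instance Definition _ (R : Type) := boolp.gen_eqMixin (fps R).
HB.instance Definition _ (R : Type) := boolp.gen_choiceMixin (fps R).

Section Zmodule.
Variable R : zmodType.
Implicit Types f g : fps R.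

Definition fps_zero : fps R := FPS (fun=> 0).
Definition fps_opp f : fps R := FPS (fun n => - fpscoef f n).
Definition fps_add f g : fps R := FPS (fun n => fpscoef f n + fpscoef g n).

Fact fps_addA : associative fps_add.
Proof. by move=> f g h; apply: fpsP => n; apply: addrA. Qed.
Fact fps_addC : commutative fps_add.
Proof. by move=> f g; apply: fpsP => n; apply: addrC. Qed.
Fact fps_add0 : left_id fps_zero fps_add.
Proof. by move=> f; apply: fpsP => n; apply: add0r. Qed.
Fact fps_addN : left_inverse fps_zero fps_opp fps_add.
Proof. by move=> f; apply: fpsP => n; apply: addNr. Qed.

HB.instance Definition _ :=
  GRing.isZmodule.Build (fps R) fps_addA fps_addC fps_add0 fps_addN.

Lemma fpscoef0 n : fpscoef (0 : fps R) n = 0. Proof. by []. Qed.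
Lemma fpscoefN f n : fpscoef (- f) n = - fpscoef f n. Proof. by []. Qed.
Lemma fpscoefD f g n : fpscoef (f + g) n = fpscoef f n + fpscoef g n.
Proof. by []. Qed.
Lemma fpscoefB f g n : fpscoef (f - g) n = fpscoef f n - fpscoef g n.
Proof. by []. Qed.
Lemma fpscoef_sum (I : Type) (r : seq I) (P : pred I) (F : I -> fps R) n :
  fpscoef (\sum_(i <- r | P i) F i) n = \sum_(i <- r | P i) fpscoef (F i) n.
Proof. by elim/big_rec2: _ => //= i u v _ <-. Qed.

End Zmodule.

Section Ring.
Variable R : comNzRingType.
Implicit Types f g : fps R.

Definition fpsC (c : R) : fps R := FPS (fun n => if n == 0%N then c else 0).
Definition fpsX : fps R := FPS (fun n => (n == 1%N)%:R).
Definition fps_mul f g : fps R :=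
  FPS (fun n => \sum_(i < n.+1) fpscoef f i * fpscoef g (n - i)).

Definition fps_trunc N f : {poly R} := \poly_(i < N) fpscoef f i.

Lemma coef_fps_trunc N f n : (n < N)%N -> (fps_trunc N f)`_n = fpscoef f n.
Proof. by rewrite coef_poly => ->. Qed.

Lemma fps_mul_trunc N f g n : (n < N)%N ->
  fpscoef (fps_mul f g) n = (fps_trunc N f * fps_trunc N g)`_n.
Proof.
move=> ltnN; rewrite coefM; apply: eq_bigr => -[i /= lein] _.
by rewrite !coef_fps_trunc //; apply: leq_ltn_trans ltnN; rewrite ?leq_subr.
Qed.

Fact fps_mulC : commutative fps_mul.
Proof.
move=> f g; apply: fpsP => n.
by rewrite (@fps_mul_trunc n.+1) // mulrC -(@fps_mul_trunc n.+1).
Qed.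

Fact fps_mulA : associative fps_mul.
Proof.
move=> f g h; apply: fpsP => n.
transitivity ((fps_trunc n.+1 f * fps_trunc n.+1 g * fps_trunc n.+1 h)`_n).
  rewrite -mulrA coefM; apply: eq_bigr => i _.
  by rewrite coef_fps_trunc // -(@fps_mul_trunc n.+1) // ltnS leq_subr.
rewrite coefM; apply: eq_bigr => i _.
by rewrite coef_fps_trunc ?ltnS ?leq_subr // -(@fps_mul_trunc n.+1).
Qed.

Fact fps_mulCl c f n : fpscoef (fps_mul (fpsC c) f) n = c * fpscoef f n.
Proof.
rewrite /= big_ord_recl /= subn0 big1 ?addr0 // => i _.
by rewrite mul0r.
Qed.

Fact fps_mul1 : left_id (fpsC 1) fps_mul.
Proof. by move=> f; apply: fpsP => n; rewrite fps_mulCl mul1r. Qed.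

Fact fps_mulDl : left_distributive fps_mul (@fps_add R).
Proof.
move=> f g h; apply: fpsP => n /=.
by rewrite -big_split; apply: eq_bigr => i _; rewrite mulrDl.
Qed.

Fact fps_oner_neq0 : fpsC 1 != 0.
Proof.
apply/eqP => /(congr1 (fun f => fpscoef f 0)) /eqP.
by rewrite /= oner_eq0.
Qed.

HB.instance Definition _ := GRing.Zmodule_isComNzRing.Build (fps R)
  fps_mulA fps_mulC fps_mul1 fps_mulDl fps_oner_neq0.

Lemma fpscoef1 n : fpscoef (1 : fps R) n = (n == 0%N)%:R.
Proof. by case: n. Qed.
Lemma fpscoefC c n : fpscoef (fpsC c) n = if n == 0%N then c else 0.
Proof. by []. Qed.
Lemma fpscoefX n : fpscoef fpsX n = (n == 1%N)%:R.
Proof. by []. Qed.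
Lemma fpscoefM f g n :
  fpscoef (f * g) n = \sum_(i < n.+1) fpscoef f i * fpscoef g (n - i).
Proof. by []. Qed.
Lemma fpscoefCM c f n : fpscoef (fpsC c * f) n = c * fpscoef f n.
Proof. exact: fps_mulCl. Qed.
Lemma fpscoef0M f g : fpscoef (f * g) 0 = fpscoef f 0 * fpscoef g 0.
Proof. by rewrite fpscoefM big_ord1. Qed.

Lemma fpscoefM_eq f g1 g2 n :
    (forall i, (i <= n)%N -> fpscoef g1 i = fpscoef g2 i) ->
  fpscoef (f * g1) n = fpscoef (f * g2) n.
Proof.
by move=> eqg; apply: eq_bigr => i _; rewrite eqg ?leq_subr.
Qed.

Lemma fpscoefX_lt f k n : fpscoef f 0 = 0 -> (n < k)%N ->
  fpscoef (f ^+ k) n = 0.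
Proof.
move=> f0; elim: k n => // k IHk n ltnk.
rewrite exprS fpscoefM big_ord_recl f0 mul0r add0r big1 // => i _.
rewrite IHk ?mulr0 //= /bump /=; case: n ltnk i => [|n] ltnk [i lti] //=.
by rewrite add1n subSS; apply: leq_ltn_trans (leq_subr _ _) _.
Qed.

End Ring.

Arguments fpsX {R}.

Section UnitRing.
Variable R : comUnitRingType.
Implicit Types f g : fps R.

Definition fps_unit : {pred fps R} :=
  [pred f | fpscoef f 0 \is a GRing.unit].

(* Geometric series: 1 / f = c * \sum_k (1 - c f) ^ k with c = 1 / f(0); as
   1 - c f has no constant term, the terms with k > n do not contribute to
   the coefficient of order n. *)
Definition fps_geom f n : fps R :=
  let c := fpsC (fpscoef f 0)^-1 in c * \sum_(k < n.+1) (1 - c * f) ^+ k.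
Definition fps_inv f : fps R :=
  if f \in fps_unit then FPS (fun n => fpscoef (fps_geom f n) n) else f.

Fact fps_mulV : {in fps_unit, left_inverse 1 fps_inv *%R}.
Proof.
move=> f uf; rewrite mulrC /fps_inv uf; move: uf; rewrite inE => uf.
set c := fpsC (fpscoef f 0)^-1; pose u := 1 - c * f.
have u0 : fpscoef u 0 = 0 by rewrite fpscoefB fpscoefCM mulVr // fpscoef1 subrr.
apply: fpsP => n.
rewrite (@fpscoefM_eq _ _ _ (fps_geom f n)); last first.
  move=> i lein; rewrite -[LHS]/(fpscoef (fps_geom f i) i).
  rewrite /fps_geom -/c -/u !fpscoefCM; congr (_ * _).
  rewrite !fpscoef_sum (big_ord_widen n.+1 (fun k => fpscoef (u ^+ k) i)) //.
  rewrite big_mkcond; apply: eq_bigr => k _; case: ifP => // /negbT.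
  by rewrite -leqNgt => ltik; rewrite fpscoefX_lt.
rewrite /fps_geom -/c -/u mulrA [f * c]mulrC.
have -> : c * f = - (u - 1) by rewrite /u opprB subKr.
by rewrite mulNr -subrX1 opprB fpscoefB [X in _ - X]fpscoefX_lt // subr0.
Qed.

Fact fps_unitPl f g : g * f = 1 -> f \in fps_unit.
Proof.
move=> /(congr1 (fun h => fpscoef h 0)); rewrite fpscoef0M fpscoef1 => gf1.
by rewrite inE; apply/unitrP; exists (fpscoef g 0); split; rewrite // mulrC.
Qed.

Fact fps_inv_out : {in [predC fps_unit], fps_inv =1 id}.
Proof. by move=> f nuf; rewrite /fps_inv ifN. Qed.

HB.instance Definition _ := GRing.ComNzRing_hasMulInverse.Build (fps R)
  fps_mulV fps_unitPl fps_inv_out.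

Lemma fps_unitE f :
  (f \is a GRing.unit) = (fpscoef f 0 \is a GRing.unit).
Proof. by []. Qed.

End UnitRing.

(* Formal convergence: each coefficient is eventually constant. *)
Definition fps_cvg (R : Type) (F : nat -> fps R) (L : fps R) : Prop :=
  forall n, exists N0, forall N, (N0 <= N)%N -> fpscoef (F N) n = fpscoef L n.

(** * Gaussian binomials and the polynomials P_h *)

Section Gauss.
Variable S : comNzRingType.
Implicit Types X Q : S.

(* The value at Q of the Gaussian binomial polynomial, by the q-Pascal rule;
   [gauss_binE] (at Q = 'X in {poly int}) is the usual product formula. *)
Fixpoint gauss_bin (N m : nat) Q : S :=
  match N, m with
  | _, 0 => 1
  | 0, _.+1 => 0
  | N'.+1, m'.+1 => gauss_bin N' m' Q + Q ^+ m * gauss_bin N' m Q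
  end.

Lemma gauss_bin0 N Q : gauss_bin N 0 Q = 1.
Proof. by case: N. Qed.

Lemma gauss_binE N m Q :
  gauss_bin N m Q * \prod_(i < m) (1 - Q ^+ i.+1)
    = \prod_(i < m) (1 - Q ^+ (N - i)).
Proof.
elim: N m => [|N IHN] [|m] /=; rewrite ?big_ord0 ?mulr1 //.
  by rewrite mul0r big_ord_recl subnn expr0 subrr mul0r.
rewrite mulrDl -mulrA IHN big_ord_recr /= mulrA IHN.
rewrite [RHS]big_ord_recl subn0 [X in _ + _ * X]big_ord_recr /=.
have -> : \prod_(i < m) (1 - Q ^+ (N.+1 - bump 0 i))
        = \prod_(i < m) (1 - Q ^+ (N - i)).
  by apply: eq_bigr => i _; rewrite /bump add1n subSS.
rewrite mulrCA [RHS]mulrC -mulrDr.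
have [lemN|ltNm] := leqP m N.
  by congr (_ * _); rewrite mulrBr mulr1 -exprD addSn subnKC // addrA subrK.
suff -> : \prod_(i < m) (1 - Q ^+ (N - i)) = 0 by rewrite !mul0r.
by rewrite (bigD1 (Ordinal ltNm)) //= subnn expr0 subrr mul0r.
Qed.

Definition Ppoly (h : nat) X Q : S :=
  \sum_(m < h./2.+1) (- X) ^+ m * Q ^+ (m * (m - 1)) * gauss_bin (h - m) m Q.

End Gauss.

(* The denominators in the product formula are invertible power series. *)
Lemma Ppoly_unit (R : comUnitRingType) h (c Q : R) :
  Ppoly h (fpsC c * fpsX) (fpsC Q) \is a GRing.unit.
Proof.
rewrite fps_unitE fpscoef_sum big_ord_recl big1 => [|i _].
  by rewrite gauss_bin0 mulr1 mul0n !expr0 mulr1 fpscoef1 addr0 unitr1.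
rewrite !fpscoef0M fpscoefX_lt ?mul0r //.
by rewrite fpscoefN fpscoefCM fpscoefX mulr0 oppr0.
Qed.

(** * Dyck paths and their statistics *)

(* A path is its word of steps: true is U = (1,1), false is D = (1,-1). *)
Definition dyck (s : seq bool) : bool :=
  [forall i : 'I_(size s).+1,
     (count_mem false (take i s) <= count_mem true (take i s))%N]
  && (count_mem true s == count_mem false s).

(* Height of vertex i, i.e. the starting height of step i (steps are numbered
   from 0); the subtraction does not truncate on Dyck paths. *)
Definition level (s : seq bool) (i : nat) : nat :=
  (count_mem true (take i s) - count_mem false (take i s))%N.

Definition height (s : seq bool) : nat :=
  (\max_(i < (size s).+1) level s i)%N.

Definition area (s : seq bool) : nat := (\sum_(i < size s) level s i)%N.

(* Index of the first up-step from level k - 1 to level k. *)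
Definition first_up (s : seq bool) (k : nat) : nat :=
  find (fun i => nth false s i && (level s i == k.-1)) (iota 0 (size s)).

(* Index of the last down-step from level k to level k - 1. *)
Definition last_down (s : seq bool) (k : nat) : nat :=
  (\max_(i < size s | ~~ nth false s i && (level s i == k)) i)%N.

Definition between (s : seq bool) (i j : nat) : seq bool :=
  drop i.+1 (take j s).

(* Words forget the starting point of a path, so that reflecting a gap in a
   horizontal line and translating it to the axis just swaps U and D. *)
Definition reflect_path (s : seq bool) : seq bool := map negb s.

Definition left_gap (s : seq bool) (k : nat) : seq bool :=
  between s (first_up s k) (first_up s k.+1).

Definition right_gap (s : seq bool) (k : nat) : seq bool :=
  between s (last_down s k.+1) (last_down s k).

Definition top_gap (s : seq bool) : seq bool :=
  between s (first_up s (height s)) (last_down s (height s)).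

Definition water (s : seq bool) : nat :=
  if height s == 0%N then 0%N else
  (\sum_(1 <= k < height s) (area (reflect_path (left_gap s k))
                             + area (reflect_path (right_gap s k)))
   + area (reflect_path (top_gap s)))%N.

(** * Generating functions, as power series in x *)

Section GeneratingFunctions.
Variable R : comNzRingType.
Implicit Types y p q : R.

Definition dyck_weight y p q (s : seq bool) : R :=
  y ^+ height s * p ^+ water s * q ^+ area s.

Definition GN (N : nat) y p q : fps R :=
  FPS (fun n => \sum_(s : (2 * n).-tuple bool | dyck s && (height s <= N)%N)
                  dyck_weight y p q s).

Definition G y p q : fps R :=
  FPS (fun n => \sum_(s : (2 * n).-tuple bool | dyck s)
                  dyck_weight y p q s).

End GeneratingFunctions.

(* Main.v *)
(** Mark the first up-step from level k and the last down-step to level k of a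
    path from level k to itself with peak h > k: the path reads L U M D R, where
    L and R are gaps at level k and M is a path from level k + 1 to itself with
    peak h.  This factorization is unique, and the water capacity is the sum of
    the reflected areas of all gaps met when iterating it.  Hence, F_k denoting
    the generating function of the gaps at level k, the paths of height h
    contribute x^h y^h q^(h^2) F_0^2 ... F_(h-1)^2 F_h.  Decomposing gaps at
    their first return writes F_k as a finite continued fraction whose partial
    numerators x p^(2j+1) q^(2k-1-2j) are in geometric progression of ratio
    Q = p^2 / q^2; by the recurrence
    P_(h+2)(X) = P_(h+1)(X Q) - X P_h(X Q^2), coming from the q-Pascal rule, its
    value is F_k = P_k(X Q) / P_(k+1)(X) at X = q^(2k-1) p x, and the product of
    the F_k telescopes. *)

Require Import Defs.
From mathcomp Require Import all_boot all_order all_algebra.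
From mathcomp Require Import zify ring.

Import GRing.Theory.
Local Open Scope ring_scope.

Set Implicit Arguments.
Unset Strict Implicit.
Unset Printing Implicit Defensive.

(** * Lattice paths started at an arbitrary level *)

Local Open Scope nat_scope.

Implicit Types (s t L M : seq bool) (a b k h i n : nat).

(* Truncates at 0; harmless on the paths singled out by [nonneg]. *)
Definition step a (c : bool) := if c then a.+1 else a.-1.

Fixpoint endpoint a s :=
  if s is c :: s' then endpoint (step a c) s' else a.

Fixpoint nonneg a s :=
  if s is c :: s' then (c || (0 < a)) && nonneg (step a c) s' else true.

Fixpoint peak a s :=
  if s is c :: s' then maxn a (peak (step a c) s') else a.

Fixpoint level_sum (f : nat -> nat) a s :=
  if s is c :: s' then f a + level_sum f (step a c) s' else 0.

(** Only level [0] bounds the path from below, so it may dip under its base [a]; [excursion k k]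
    singles out the gaps at level [k]. *)
Definition excursion a h s :=
  [&& nonneg a s, endpoint a s == a & peak a s == h].

Lemma endpoint_cat a s t : endpoint a (s ++ t) = endpoint (endpoint a s) t.
Proof. by elim: s a => //= c s IHs a; rewrite IHs. Qed.

Lemma nonneg_cat a s t :
  nonneg a (s ++ t) = nonneg a s && nonneg (endpoint a s) t.
Proof. by elim: s a => //= c s IHs a; rewrite IHs andbA. Qed.

Lemma peak_ge a s : a <= peak a s.
Proof. by case: s => //= c s; rewrite leq_maxl. Qed.

Lemma endpoint_le_peak a s : endpoint a s <= peak a s.
Proof. by elim: s a => //= c s IHs a; rewrite leq_max IHs orbT. Qed.

Lemma peak_cat a s t :
  peak a (s ++ t) = maxn (peak a s) (peak (endpoint a s) t).
Proof.
elim: s a => [|c s IHs] a /=; last by rewrite IHs maxnA.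
by rewrite (maxn_idPr (peak_ge _ _)).
Qed.

Lemma level_sum_cat f a s t :
  level_sum f a (s ++ t) = level_sum f a s + level_sum f (endpoint a s) t.
Proof. by elim: s a => //= c s IHs a; rewrite IHs addnA. Qed.

Lemma endpoint_count a s : nonneg a s ->
  endpoint a s + count_mem false s = a + count_mem true s.
Proof.
elim: s a => //= c s IHs a /andP[ca /IHs].
by case: c ca => //= [_|a0] E; rewrite /=; lia.
Qed.

Lemma nonneg_take a s i : nonneg a s -> nonneg a (take i s).
Proof. by rewrite -{1}(cat_take_drop i s) nonneg_cat => /andP[]. Qed.

Lemma peak_take a s i : peak a (take i s) <= peak a s.
Proof. by rewrite -{2}(cat_take_drop i s) peak_cat leq_maxl. Qed.

Lemma nonnegP a s :
  reflect (forall i, count_mem false (take i s)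
                     <= a + count_mem true (take i s)) (nonneg a s).
Proof.
apply: (iffP idP) => [sa i|]; first by have := endpoint_count (nonneg_take i sa); lia.
elim: s a => //= c s IHs a H; apply/andP; split.
  by have := H 1; case: c {H} => //=; rewrite take0 /=; lia.
apply: IHs => i; have := H i.+1; have := H 1; rewrite /= take0.
by case: c {H} => /=; lia.
Qed.

Lemma sum_endpoint f a s :
  \sum_(i < size s) f (endpoint a (take i s)) = level_sum f a s.
Proof.
elim: s a => [|c s IHs] a /=; first by rewrite big_ord0.
by rewrite big_ord_recl /= -IHs.
Qed.

Lemma bigmax_endpoint a s :
  \max_(i < (size s).+1) endpoint a (take i s) = peak a s.
Proof.
elim: s a => [|c s IHs] a /=.
  by rewrite big_ord_recl big_ord0 maxn0.
by rewrite big_ord_recl /= -IHs.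
Qed.

(** On a nonnegative path neither the subtraction in [level] nor the predecessor in [step]
    truncates. *)
Lemma levelE s i : nonneg 0 s -> level s i = endpoint 0 (take i s).
Proof. by move=> /(nonneg_take i)/endpoint_count; rewrite /level; lia. Qed.

Lemma areaE s : nonneg 0 s -> area s = level_sum id 0 s.
Proof.
move=> s0; rewrite -sum_endpoint; apply: eq_bigr => i _; exact: levelE.
Qed.

Lemma heightE s : nonneg 0 s -> height s = peak 0 s.
Proof.
move=> s0; rewrite -bigmax_endpoint; apply: eq_bigr => i _; exact: levelE.
Qed.

Lemma dyckE s : dyck s = nonneg 0 s && (endpoint 0 s == 0).
Proof.
rewrite /dyck; have -> : [forall i : 'I_(size s).+1,
     count_mem false (take i s) <= count_mem true (take i s)] = nonneg 0 s.
  apply/forallP/nonnegP => [H i|H i]; last exact: H.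
  have [lti|gei] := ltnP i (size s).+1; first exact: (H (Ordinal lti)).
  by have := H ord_max; rewrite /= take_size take_oversize // ltnW.
case s0: (nonneg 0 s) => //=; have E := endpoint_count s0.
by rewrite -[RHS](eqn_add2r (count_mem false s)) E !add0n.
Qed.

Lemma dyck_excursion h s : dyck s && (height s == h) = excursion 0 h s.
Proof.
rewrite dyckE /excursion; case s0: (nonneg 0 s) => //=.
by rewrite heightE.
Qed.

(** Where the path is at level [l], its reflection is at level [k - l]; the bound on the peak keeps
    this difference from truncating. *)
Lemma area_reflect k s : nonneg k s -> peak k s <= k ->
  area (reflect_path s) = level_sum (subn k) k s.
Proof.
move=> sk pk; rewrite -sum_endpoint /area size_map; apply: eq_bigr => i _.
have E j : count_mem (~~ j) (take i (reflect_path s)) = count_mem j (take i s).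
  by rewrite -map_take count_map; apply: eq_count => -[]; case: j.
rewrite /level (E false) (E true).
have := endpoint_count (nonneg_take i sk).
have := endpoint_le_peak k (take i s); have := peak_take k s i; lia.
Qed.

(** Up-steps and down-steps are equally many. Evenness guarantees that the cuts after excursions are
    among the even positions seen by [conv]. *)
Lemma excursion_even a h s : excursion a h s -> ~~ odd (size s).
Proof.
case/and3P=> /endpoint_count E /eqP Ea _.
rewrite -(count_predC (pred1 true)).
rewrite (@eq_count _ (predC (pred1 true)) (pred1 false)); last by case.
by rewrite oddD; move: E; rewrite Ea => /addnI <-; rewrite addbb.
Qed.

Lemma excursion0 s : excursion 0 0 s = (s == [::]).
Proof.
case: s => // -[] s //=; rewrite /excursion /=.
by rewrite max0n [peak 1 s == 0]gtn_eqF ?andbF //; apply: (peak_ge 1).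
Qed.

Lemma first_passage k a s : a <= k < peak a s ->
  exists L t, [/\ s = L ++ true :: t, endpoint a L = k & peak a L <= k].
Proof.
elim: s a => [|c s IHs] a /=; first by case: ltngtP.
case/andP=> leak; case: (boolP ((a == k) && c)) => [/andP[/eqP <- ->] _|ak].
  by exists [::], s.
rewrite leq_max ltnNge leak /= => lks.
have leck : step a c <= k by case: c ak {lks} => /=; lia.
have [|L [t [-> eL pL]]] := IHs (step a c); first by rewrite leck lks.
by exists (c :: L), t; split => //=; rewrite geq_max leak.
Qed.

Lemma last_passage k a s : endpoint a s <= k < peak a s ->
  exists M t, [/\ s = M ++ false :: t, endpoint a M = k.+1 & peak k t <= k].
Proof.
elim/last_ind: s => [|s c IHs] /=; first by rewrite /=; case: ltngtP.
rewrite -cats1 endpoint_cat peak_cat /= => /andP[lek ltk].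
case: (leqP (endpoint a s) k) => [sk|].
  have [|M [t [E eM pt]]] := IHs.
    rewrite sk /=; move: ltk lek; rewrite /=; lia.
  exists M, (t ++ [:: c]); split => //; first by rewrite E -catA.
  have Et : endpoint k t = endpoint a s by rewrite E endpoint_cat eM.
  by rewrite peak_cat geq_max pt /= Et geq_max sk.
move=> ks; exists s, [::]; rewrite /= leqnn.
by case: c lek {ltk}; rewrite /= => lek; split => //; lia.
Qed.

Lemma cat_eq_prefix s1 s2 t1 t2 : s1 ++ t1 = s2 ++ t2 -> size s1 <= size s2 ->
  exists2 u, s2 = s1 ++ u & t1 = u ++ t2.
Proof.
move=> E le12; exists (drop (size s1) s2).
  rewrite -[LHS](cat_take_drop (size s1)); congr (_ ++ _).
  by have := congr1 (take (size s1)) E; rewrite take_size_cat // takel_cat.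
have := congr1 (drop (size s1)) E; rewrite drop_size_cat // => ->.
by rewrite drop_cat; case: ltngtP le12 => // -> _; rewrite subnn drop0 drop_size.
Qed.

(** If one prefix were longer, it would contain the up-step to [k.+1] that follows the other,
    against the bound on its peak. *)
Lemma first_passage_uniq k a L L' t t' :
  L ++ true :: t = L' ++ true :: t' ->
  endpoint a L = k -> endpoint a L' = k -> peak a L <= k -> peak a L' <= k ->
  L = L'.
Proof.
wlog le: L L' t t' / size L <= size L' => [wl|] E eL eL' pL pL'.
  by case/orP: (leq_total (size L) (size L')) => le;
    [|symmetry]; [exact: wl E _ _ _ _ | exact: wl (esym E) _ _ _ _].
have [[|c u] EL' Et] := cat_eq_prefix E le; first by rewrite EL' cats0.
case: Et => Ec _; move: pL'; rewrite EL' peak_cat eL -Ec /= => pL'.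
by have := peak_ge k.+1 u; move: pL'; lia.
Qed.

(** If [M'] were longer, its end at height [k.+1] would be a vertex of [t], which stays at or below
    [k]. *)
Lemma last_passage_uniq k a M M' t t' :
  M ++ false :: t = M' ++ false :: t' ->
  endpoint a M = k.+1 -> endpoint a M' = k.+1 -> peak k t <= k -> peak k t' <= k ->
  M = M'.
Proof.
wlog le: M M' t t' / size M <= size M' => [wl|] E eM eM' pt pt'.
  by case/orP: (leq_total (size M) (size M')) => le;
    [|symmetry]; [exact: wl E _ _ _ _ | exact: wl (esym E) _ _ _ _].
have [[|c u] EM' Et] := cat_eq_prefix E le; first by rewrite EM' cats0.
case: Et => Ec Et; move: eM'; rewrite EM' endpoint_cat eM -Ec /= => eu.
move: pt; rewrite Et peak_cat; have := endpoint_le_peak k u.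
by move: eu; rewrite /= => ->; lia.
Qed.

Lemma excursion_glue k h L M t : excursion k k L -> excursion k.+1 h M ->
  excursion k k t -> excursion k h (L ++ true :: M ++ false :: t).
Proof.
case/and3P=> nL /eqP eL /eqP pL /and3P[nM /eqP eM /eqP pM] /and3P[nt et pt].
rewrite /excursion nonneg_cat eL nL /= nonneg_cat nM eM /= nt /=.
rewrite endpoint_cat eL /= endpoint_cat eM /=.
rewrite peak_cat eL pL /= peak_cat eM /= (eqP pt) pM et /=.
have := peak_ge k.+1 M; rewrite pM; lia.
Qed.

Lemma excursion_split k h s : k < h -> excursion k h s ->
  exists L M t, [/\ s = L ++ true :: M ++ false :: t, excursion k k L,
                    excursion k.+1 h M & excursion k k t].
Proof.
move=> ltkh /and3P[ns /eqP es /eqP ps].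
have [|L [s' [Es eL pL]]] := @first_passage k k s; first by rewrite leqnn ps.
move: ns es ps; rewrite Es nonneg_cat eL => /andP[nL /= ns'].
rewrite endpoint_cat eL => es' ps.
have [|M [t [Es' eM pt]]] := @last_passage k k.+1 s'.
  by rewrite [endpoint _ _]es' leqnn (leq_trans _ (peak_ge _ _)).
move: ns' es' ps; rewrite Es' nonneg_cat eM /= => /andP[nM nt].
rewrite /= endpoint_cat eM => et ps.
have pL' : peak k L = k by apply/eqP; rewrite eqn_leq pL peak_ge.
have pt' : peak k t = k by apply/eqP; rewrite eqn_leq pt peak_ge.
exists L, M, t; rewrite /excursion nL eL pL' nM eM nt pt' [endpoint k t]et !eqxx.
split => //; move: ps; rewrite peak_cat eL pL' /= peak_cat eM /= pt'.
by have := peak_ge k.+1 M; lia.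
Qed.

(** * Water capacity in terms of a nested decomposition *)

Lemma first_upE k L t : endpoint 0 L = k -> peak 0 L <= k ->
  nonneg 0 (L ++ true :: t) -> first_up (L ++ true :: t) k.+1 = size L.
Proof.
move=> eL pL ns; rewrite /first_up size_cat iotaD find_cat add0n ifN.
  rewrite /= nth_cat ltnn subnn levelE // take_size_cat // eL eqxx /=.
  by rewrite addn0 size_iota.
(* An up-step from level [k] inside [L] would lift [L] above its peak. *)
apply/hasPn => i; rewrite mem_iota add0n => /andP[_ lti].
rewrite nth_cat lti levelE // takel_cat 1?ltnW //=.
apply/negP => /andP[ni /eqP ei].
have := leq_trans (endpoint_le_peak 0 _) (peak_take 0 L i.+1).
rewrite (take_nth false) // ni -cats1 endpoint_cat ei /=.
by rewrite /=; lia.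
Qed.

Lemma last_downE k M t : endpoint 0 M = k.+1 -> peak k t <= k ->
  nonneg 0 (M ++ false :: t) -> last_down (M ++ false :: t) k.+1 = size M.
Proof.
move=> eM pt ns; rewrite /last_down; set s := M ++ _.
have ltM : size M < size s by rewrite size_cat /=; lia.
apply/eqP; rewrite eqn_leq; apply/andP; split; last first.
  apply: (leq_bigmax_cond (Ordinal ltM)) => /=.
  by rewrite nth_cat ltnn subnn levelE // take_size_cat // eM eqxx.
apply/bigmax_leqP => -[i lti] /= /andP[_]; rewrite levelE // leqNgt => ei.
apply/negP => ltMi; move: ei; rewrite take_cat ltnNge (ltnW ltMi) /=.
(* The down-step at position [size M] precedes [t], so vertex [i] of [s] is vertex [i - size M - 1]
   of [t]. *)
rewrite -[i - size M]prednK ?subn_gt0 //= endpoint_cat eM => ei.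
have := leq_trans (endpoint_le_peak k _) (peak_take k t (i - size M).-1).
by move: ei; rewrite /= => /eqP ->; lia.
Qed.

Lemma between_cat L M t c :
  between (L ++ c :: M ++ t) (size L) (size L + (size M).+1) = M.
Proof.
rewrite /between -cat_cons catA take_size_cat ?size_cat //.
by rewrite -cat_rcons drop_size_cat // size_rcons.
Qed.

(* The water of the gaps at levels k, ..., h - 1 and of the top gap, when h is
   the height of s. *)
Definition water_above s k h :=
  \sum_(k <= j < h) (area (reflect_path (left_gap s j))
                     + area (reflect_path (right_gap s j)))
  + area (reflect_path (between s (first_up s h) (last_down s h))).

Lemma water_above_top k A M B :
  nonneg 0 (A ++ true :: M ++ false :: B) -> endpoint 0 A = k -> peak 0 A <= k ->
  peak k B <= k -> excursion k.+1 k.+1 M ->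
  water_above (A ++ true :: M ++ false :: B) k.+1 k.+1
    = level_sum (subn k.+1) k.+1 M.
Proof.
move=> ns eA pA pB /and3P[nM /eqP eM /eqP pM].
rewrite /water_above big_geq // add0n first_upE //.
move: (ns); rewrite -cat_rcons catA => ns'; rewrite last_downE //; last first.
  by rewrite -cats1 -catA endpoint_cat eA.
rewrite size_cat size_rcons addSnnS -catA cat_rcons between_cat.
by rewrite (area_reflect nM) ?pM.
Qed.

Lemma water_above_split k h A L M t B :
  let s := A ++ true :: (L ++ true :: M ++ false :: t) ++ false :: B in
  nonneg 0 s -> endpoint 0 A = k -> peak 0 A <= k -> peak k B <= k ->
  excursion k.+1 k.+1 L -> excursion k.+2 h M -> excursion k.+1 k.+1 t ->
  k.+1 < h ->
  water_above s k.+1 h = level_sum (subn k.+1) k.+1 L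
    + level_sum (subn k.+1) k.+1 t + water_above s k.+2 h.
Proof.
move=> s ns eA pA pB /and3P[nL /eqP eL /eqP pL] /and3P[nM /eqP eM _].
move=> /and3P[nt /eqP et /eqP pt] ltkh.
rewrite /water_above big_ltn // -!addnA; congr (_ + _).
  rewrite /left_gap first_upE //.
  have Es : s = (A ++ true :: L) ++ true :: M ++ false :: t ++ false :: B.
    by rewrite /s -!catA /= -!catA.
  have -> : first_up s k.+2 = size A + (size L).+1.
    rewrite Es first_upE -?Es ?size_cat ?endpoint_cat ?eA ?peak_cat //.
    by rewrite eA /= pL; lia.
  by rewrite /s -!catA between_cat (area_reflect nL) ?pL.
congr (_ + _).
set C := A ++ true :: L ++ true :: M.
rewrite /right_gap; have Es : s = C ++ false :: t ++ false :: B.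
  by rewrite /s /C -!catA /= -!catA.
have eC : endpoint 0 C = k.+2 by rewrite /C endpoint_cat eA /= endpoint_cat eL.
have -> : last_down s k.+2 = size C.
  rewrite Es last_downE -?Es // peak_cat pt et /=.
  by move: pB; lia.
have -> : last_down s k.+1 = size C + (size t).+1.
  have Es' : s = (C ++ false :: t) ++ false :: B by rewrite Es -catA.
  rewrite Es' last_downE -?Es' //; first exact: size_cat.
  by rewrite endpoint_cat eC.
by rewrite Es between_cat (area_reflect nt) ?pt.
Qed.

Lemma waterE s : height s != 0 -> water s = water_above s 1 (height s).
Proof. by rewrite /water => /negPf ->. Qed.

(** * Weighted sums over words *)

Local Open Scope ring_scope.

Section WordSums.
Variable R : comNzRingType.
Implicit Types (f g : seq bool -> R) (x y p q : R).

Definition word_sum m f : R := \sum_(t : m.-tuple bool) f t.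

Lemma word_sum0 f : word_sum 0 f = f [::].
Proof.
rewrite /word_sum (bigD1 [tuple]) //= big1 ?addr0 // => t.
by rewrite [t]tuple0 => /eqP[].
Qed.

Lemma word_sumS m f :
  word_sum m.+1 f = \sum_(c : bool) word_sum m (fun s => f (c :: s)).
Proof.
rewrite /word_sum pair_big /=.
rewrite (reindex (fun u : bool * m.-tuple bool => [tuple of u.1 :: u.2])) //=.
exists (fun t : m.+1.-tuple bool => (thead t, [tuple of behead t])) => /= [[c t]|t] _.
  by congr pair; apply: val_inj.
by rewrite -tuple_eta.
Qed.

Lemma eq_word_sum m f g : (forall s, size s = m -> f s = g s) ->
  word_sum m f = word_sum m g.
Proof. by move=> fg; apply: eq_bigr => t _; rewrite fg ?size_tuple. Qed.

Lemma word_sum_cat m n f :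
  word_sum (m + n) f = word_sum m (fun s => word_sum n (fun t => f (s ++ t))).
Proof.
elim: m f => [|m IHm] f; first by rewrite word_sum0.
by rewrite addSn !word_sumS; apply: eq_bigr => c _; rewrite IHm.
Qed.

Lemma word_sum_rcons m f :
  word_sum m.+1 f = word_sum m (fun s => \sum_(c : bool) f (rcons s c)).
Proof.
rewrite -addn1 word_sum_cat; apply: eq_word_sum => s _.
by rewrite word_sumS; apply: eq_bigr => c _; rewrite word_sum0 cats1.
Qed.

Definition genfun f : fps R := FPS (fun n => word_sum (2 * n) f).

(* The product of noncommutative power series, restricted to splittings at
   even positions: this makes [genfun], which only sees words of even length,
   multiplicative without any hypothesis. *)
Definition conv f g s : R :=
  \sum_(i < (size s)./2.+1) f (take (2 * i) s) * g (drop (2 * i) s).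

Lemma genfun_conv f g : genfun (conv f g) = genfun f * genfun g.
Proof.
apply: fpsP => n; rewrite fpscoefM /=.
transitivity (\sum_(t : (2 * n).-tuple bool)
                 \sum_(i < n.+1) f (take (2 * i) t) * g (drop (2 * i) t)).
  by apply: eq_bigr => t _; rewrite /conv size_tuple (_ : ((2 * n)./2 = n)%N) // mul2n doubleK.
rewrite exchange_big; apply: eq_bigr => -[i /= lein] _.
rewrite -/(word_sum _ (fun s => f (take (2 * i) s) * g (drop (2 * i) s))).
have -> : (2 * n = 2 * i + 2 * (n - i))%N by lia.
rewrite word_sum_cat mulr_suml; apply: eq_bigr => s _.
rewrite mulr_sumr; apply: eq_bigr => t _.
by rewrite take_size_cat ?size_tuple // drop_size_cat ?size_tuple.
Qed.

(** Evenness puts the cut after [s] among the summands; uniqueness of the factorization kills all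
    the others. *)
Lemma conv_cat f g s t : ~~ odd (size s) ->
    (forall s' t', s ++ t = s' ++ t' -> f s' != 0 -> g t' != 0 -> s' = s) ->
  conv f g (s ++ t) = f s * g t.
Proof.
move=> evs uniq_st.
have Es : (2 * (size s)./2 = size s)%N by rewrite mul2n even_halfK.
have lts : ((size s)./2 < (size (s ++ t))./2.+1)%N.
  by rewrite ltnS half_leq // size_cat leq_addr.
rewrite /conv (bigD1 (Ordinal lts)) //= Es take_size_cat // drop_size_cat //.
rewrite big1 ?addr0 // => -[i lti] /= neq_i.
have [-> |fi] := eqVneq (f (take (2 * i) (s ++ t))) 0; first by rewrite mul0r.
have [-> |gi] := eqVneq (g (drop (2 * i) (s ++ t))) 0; first by rewrite mulr0.
have := uniq_st _ _ (esym (cat_take_drop (2 * i) _)) fi gi.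
move/(congr1 size); rewrite size_takel; last first.
  by move: (lti); rewrite ltnS geq_half_double -mul2n.
by move=> E; case/eqP: neq_i; apply: val_inj => /=; rewrite -E mul2n doubleK.
Qed.

Lemma conv_supp f g s : conv f g s != 0 ->
  exists t u, [/\ s = t ++ u, f t != 0 & g u != 0].
Proof.
move=> nz.
have [i fgi] : exists i : 'I_(size s)./2.+1,
    f (take (2 * i) s) * g (drop (2 * i) s) != 0.
  apply/existsP; apply: contraNT nz; rewrite negb_exists => /forallP all0.
  by rewrite /conv big1 // => i _; apply/eqP; rewrite -[_ == _]negbK all0.
exists (take (2 * i) s), (drop (2 * i) s); rewrite cat_take_drop; split => //.
  by apply: contraNneq fgi => ->; rewrite mul0r.
by apply: contraNneq fgi => ->; rewrite mulr0.
Qed.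

(** Matching on two letters makes the first and last letters distinct positions; [belast c' s'] is
    the word between them. *)
Definition wrap (b c : bool) x f s : R :=
  if s is b' :: c' :: s' then
    if (b' == b) && (last c' s' == c) then x * f (belast c' s') else 0
  else 0.

#[local] Arguments wrap : simpl never.

Lemma wrap_rcons (b b' c c' : bool) x f s :
  wrap b c x f (b' :: rcons s c')
    = if (b' == b) && (c' == c) then x * f s else 0.
Proof. by rewrite /wrap; case: s => [|a s] //=; rewrite last_rcons belast_rcons. Qed.

Lemma wrap_supp (b c : bool) x f s : wrap b c x f s != 0 ->
  exists2 t, s = b :: rcons t c & f t != 0.
Proof.
case: s => [|b' s]; first by rewrite eqxx.
case/lastP: s => [|s c']; first by rewrite eqxx.
rewrite wrap_rcons; case: ifP => [/andP[/eqP -> /eqP ->]|]; last by rewrite eqxx.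
by move=> nz; exists s => //; apply: contraNneq nz => ->; rewrite mulr0.
Qed.

Lemma fpscoefXM0 (F : fps R) : fpscoef (fpsX * F) 0 = 0.
Proof. by rewrite fpscoef0M mul0r. Qed.

Lemma fpscoefXMS (F : fps R) n : fpscoef (fpsX * F) n.+1 = fpscoef F n.
Proof.
rewrite fpscoefM !big_ord_recl big1 => [|i _]; first by rewrite mul0r add0r mul1r addr0 subn1.
by rewrite fpscoefX mul0r.
Qed.

Lemma genfun_wrap (b c : bool) x f : genfun (wrap b c x f) = fpsC x * fpsX * genfun f.
Proof.
apply: fpsP => -[|n]; rewrite -mulrA fpscoefCM.
  by rewrite fpscoefXM0 mulr0 /= muln0 word_sum0.
rewrite fpscoefXMS /= mulnS word_sumS (bigD1 b) //= big1 => [|b' neq_b].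
  rewrite addr0 word_sum_rcons mulr_sumr; apply: eq_bigr => s _.
  rewrite (bigD1 c) //= big1 ?addr0 => [|c' neq_c]; rewrite wrap_rcons ?eqxx //.
  by rewrite (negPf neq_c) andbF.
rewrite word_sum_rcons /word_sum big1 // => s _; rewrite big1 // => c' _.
by rewrite wrap_rcons (negPf neq_b).
Qed.

(** * The generating functions of gaps and of excursions *)

Variables p q : R.

(* The path is drawn at its true levels below r, inside a gap at level k: the
   reflection sends level l to level k - l. *)
Definition gap_weight k r s : R :=
  if excursion r r s then
    p ^+ level_sum (subn k) r s * q ^+ level_sum id r s
  else 0.

(* Weighs a path from level k to itself with peak k + d as a nested sequence
   of gaps, one pair of gaps at each of the levels k, ..., k + d - 1. *)
Fixpoint excursion_weight d k : seq bool -> R :=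
  if d is d'.+1 then
    conv (gap_weight k k)
         (conv (wrap true false (q ^+ (k + k.+1)) (excursion_weight d' k.+1))
               (gap_weight k k))
  else gap_weight k k.

(** [gap_gf k k] is the series of all gaps at level [k]; the smaller values of [r] give the tails of
    its continued fraction. *)
Definition gap_gf k r : fps R := genfun (gap_weight k r).

Lemma gap_weight_supp k r s : gap_weight k r s != 0 -> excursion r r s.
Proof. by rewrite /gap_weight; case: ifP => // _; rewrite eqxx. Qed.

(** First-return decomposition: a nonempty gap must begin with a down-step, and the first passage
    above [r] marks its return to [r.+1]. *)
Lemma gap_split r s : excursion r.+1 r.+1 s -> s != [::] ->
  exists M t, [/\ s = false :: M ++ true :: t, excursion r r M
                & excursion r.+1 r.+1 t].
Proof.
case: s => [|[] s] //= /and3P[ns /eqP /= es /eqP /= ps] _.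
  by have := peak_ge r.+2 s; move: ps; lia.
have ltr : (r < peak r s)%N by rewrite -[X in (X <= _)%N]es endpoint_le_peak.
have [|M [t [Es eM pM]]] := @first_passage r r s; first by rewrite leqnn.
move: ns es ps; rewrite {}Es /= nonneg_cat eM /= => /andP[nM nt].
rewrite endpoint_cat eM peak_cat eM /= => et ps; exists M, t.
rewrite /excursion nM eM nt et !eqxx /=; split => //.
  by rewrite eqn_leq pM peak_ge.
by have := peak_ge r.+1 t; move: ps; lia.
Qed.

Lemma gap_glue r M t : excursion r r M -> excursion r.+1 r.+1 t ->
  excursion r.+1 r.+1 (false :: M ++ true :: t).
Proof.
case/and3P=> nM /eqP eM /eqP pM /and3P[nt et /eqP pt].
rewrite /excursion /= nonneg_cat endpoint_cat peak_cat eM nM pM /= nt et pt /=.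
by lia.
Qed.

(** The two steps enclosing [M] start at levels [r.+1] and [r], hence at levels [k - r.+1] and
    [k - r] after reflection: these are the exponents of [q] and [p]. *)
Lemma gap_weight_rec k r s : gap_weight k r.+1 s = (s == [::])%:R
  + conv (wrap false true (p ^+ (k - r.+1 + (k - r)) * q ^+ (r.+1 + r))
               (gap_weight k r)) (gap_weight k r.+1) s.
Proof.
set f := wrap _ _ _ _.
have supp u : conv f (gap_weight k r.+1) u != 0 ->
    exists M t, [/\ u = false :: M ++ true :: t, excursion r r M
                  & excursion r.+1 r.+1 t].
  move=> /conv_supp[M' [t [-> /wrap_supp[M -> /gap_weight_supp exM]]]].
  by move=> /gap_weight_supp ext; exists M, t; rewrite /= cat_rcons.
have [-> | s0] := eqVneq s [::].
  have [-> | /supp[? [?]] []//] := eqVneq (conv f (gap_weight k r.+1) [::]) 0.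
  by rewrite /gap_weight /excursion /= !eqxx mulr1 addr0.
rewrite add0r; have [/gap_split|nex] := boolP (excursion r.+1 r.+1 s); last first.
  rewrite /gap_weight (negPf nex); symmetry; apply/eqP; apply: contraNT nex.
  by move=> /supp[M [t [-> exM ext]]]; apply: gap_glue.
case=> // M [t [-> exM ext]].
have -> : false :: M ++ true :: t = (false :: rcons M true) ++ t.
  by rewrite /= cat_rcons.
rewrite conv_cat; first last.
- move=> M' t' Es /wrap_supp[M'' EM' /gap_weight_supp exM''] _; move: Es.
  rewrite EM' /= !cat_rcons => -[Es]; congr (_ :: rcons _ _).
  case/and3P: exM exM'' => _ /eqP eM /eqP pM /and3P[_ /eqP eM'' /eqP pM''].
  by apply: (first_passage_uniq (esym Es) eM'' eM); rewrite ?pM ?pM''.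
- by rewrite /= size_rcons /= negbK (excursion_even exM).
rewrite /f wrap_rcons /= /gap_weight exM ext cat_rcons gap_glue //=.
rewrite !level_sum_cat /=; case/and3P: exM => _ /eqP -> _ /=.
by rewrite !exprD; ring.
Qed.

Lemma gap_gf0 k : gap_gf k 0 = 1.
Proof.
have E s : gap_weight k 0 s = (s == [::])%:R.
  by rewrite /gap_weight excursion0; case: eqP => // ->; rewrite mulr1.
apply: fpsP => -[|n]; rewrite fpscoef1 /= ?muln0 ?word_sum0 ?E //.
by rewrite /word_sum big1 // => t _; rewrite E -size_eq0 size_tuple mulnS.
Qed.

(** One level of the continued fraction, left in multiplied-out form. *)
Lemma gap_gf_rec k r : gap_gf k r.+1 = 1
  + fpsC (p ^+ (k - r.+1 + (k - r)) * q ^+ (r.+1 + r)) * fpsX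
    * gap_gf k r * gap_gf k r.+1.
Proof.
rewrite /gap_gf -(genfun_wrap false true) -genfun_conv; apply: fpsP => n.
rewrite fpscoefD fpscoef1 /= {1}/word_sum.
under eq_bigr do rewrite gap_weight_rec.
rewrite big_split; congr (_ + _); case: n => [|n].
  by rewrite -/(word_sum _ (fun s => (s == [::])%:R)) muln0 word_sum0.
by rewrite big1 // => t _; rewrite -size_eq0 size_tuple mulnS.
Qed.

Lemma excursion_weight_supp d k s :
  excursion_weight d k s != 0 -> excursion k (k + d) s.
Proof.
elim: d k s => [|d IHd] k s /=; first by rewrite addn0; apply: gap_weight_supp.
move=> /conv_supp[L [u [-> /gap_weight_supp exL]]].
move=> /conv_supp[M' [t [-> /wrap_supp[M -> /IHd exM] /gap_weight_supp ext]]].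
by rewrite /= cat_rcons addnS -addSn; apply: excursion_glue.
Qed.

(** Both convolutions reduce to one term: [L] is determined by the first passage above [k], then [M]
    by the last passage down to [k]. *)
Lemma excursion_weight_glue d k L M t :
  excursion k k L -> excursion k.+1 (k.+1 + d) M -> excursion k k t ->
  excursion_weight d.+1 k (L ++ true :: M ++ false :: t)
    = gap_weight k k L
      * (q ^+ (k + k.+1) * excursion_weight d k.+1 M * gap_weight k k t).
Proof.
move=> exL exM ext /=; rewrite conv_cat; first last.
- move=> L' u' Es /gap_weight_supp exL' /conv_supp[M' [t' [Eu]]].
  move=> /wrap_supp[M'' EM' _] _; move: Es; rewrite Eu EM' /= => Es.
  case/and3P: exL exL' => _ /eqP eL /eqP pL /and3P[_ /eqP eL' /eqP pL'].
  by apply: (first_passage_uniq (esym Es) eL' eL); rewrite ?pL ?pL'.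
- exact: excursion_even exL.
congr (_ * _).
have -> : true :: M ++ false :: t = (true :: rcons M false) ++ t.
  by rewrite /= cat_rcons.
rewrite conv_cat; first by rewrite wrap_rcons.
  by rewrite /= size_rcons /= negbK (excursion_even exM).
move=> M' t' Es /wrap_supp[M'' EM' /excursion_weight_supp exM''].
move=> /gap_weight_supp ext'; move: Es; rewrite EM' /= !cat_rcons => -[Es].
congr (_ :: rcons _ _).
case/and3P: exM exM'' => _ /eqP eM _ /and3P[_ /eqP eM'' _].
case/and3P: ext ext' => _ _ /eqP pt /and3P[_ _ /eqP pt'].
by apply: (last_passage_uniq (esym Es) eM'' eM); rewrite ?pt ?pt'.
Qed.

(** Water depends on the whole path, so the induction on [d] lets the context [A], [B] vary. *)
Lemma excursion_weightE d k A M B :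
    nonneg 0 (A ++ true :: M ++ false :: B) -> endpoint 0 A = k ->
    (peak 0 A <= k)%N -> (peak k B <= k)%N -> excursion k.+1 (k.+1 + d) M ->
  excursion_weight d k.+1 M
    = p ^+ water_above (A ++ true :: M ++ false :: B) k.+1 (k.+1 + d)
      * q ^+ level_sum id k.+1 M.
Proof.
elim: d k A M B => [|d IHd] k A M B ns eA pA pB exM.
  by rewrite addn0 in exM *; rewrite water_above_top //= /gap_weight exM.
have ltk : (k.+1 < k.+1 + d.+1)%N by rewrite addnS ltnS leq_addr.
have [L [M' [t [EM exL exM' ext]]]] := excursion_split ltk exM.
rewrite {}EM in ns exM *; rewrite water_above_split //.
rewrite excursion_weight_glue //; last by rewrite addSnnS.
have Es : A ++ true :: (L ++ true :: M' ++ false :: t) ++ false :: B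
        = (A ++ true :: L) ++ true :: M' ++ false :: t ++ false :: B.
  by rewrite -!catA /= -!catA.
case/and3P: (exL) => _ /eqP eL /eqP pL; case/and3P: (exM') => _ /eqP eM' _.
case/and3P: (ext) => _ /eqP et /eqP pt.
(* One level up, the gaps [L] and [t] join the context of the inner excursion. *)
rewrite (IHd _ (A ++ true :: L) _ (t ++ false :: B)); first last.
- by rewrite addSnnS.
- by rewrite peak_cat et pt /=; move: pB; lia.
- by rewrite peak_cat eA /= pL; move: pA; lia.
- by rewrite endpoint_cat eA.
- by rewrite -Es.
rewrite /gap_weight exL ext -Es (addSnnS k.+1 d) level_sum_cat eL /= level_sum_cat eM' /=.
move: (water_above _ _ _) (level_sum _ _ L) (level_sum _ _ t) => w l t1.
by rewrite !exprD; ring.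
Qed.

(** [water] counts gaps from level [1] on. The two gaps at level [0] are empty, so a nonempty path
    is compared inside its first and last steps; height [0] is treated apart. *)
Lemma dyck_excursion_weight h s : excursion_weight h 0 s =
  if dyck s && (height s == h) then p ^+ water s * q ^+ area s else 0.
Proof.
rewrite dyck_excursion; case: ifPn => [exs|]; last first.
  by apply: contraNeq => /excursion_weight_supp.
case/and3P: (exs) => ns /eqP es /eqP ps; move: (heightE ns); rewrite ps => hs.
rewrite areaE //; case: h exs ps hs => [|h] exs _ hs.
  by rewrite /water hs /= /gap_weight exs; move: exs; rewrite excursion0 => /eqP ->.
have [//|L [M [t [Es exL exM ext]]]] := excursion_split _ exs.
have [EL Et] : L = [::] /\ t = [::].
  by split; apply/eqP; rewrite -excursion0.
rewrite waterE ?hs //; rewrite {}Es {}EL {}Et /= in ns exM *.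
have := @excursion_weight_glue h 0 [::] M [::].
rewrite /gap_weight !excursion0 /= !mul1r mulr1 add1n => -> //.
have := @excursion_weightE h 0 [::] M [::]; rewrite /= add1n => -> //.
case/and3P: exM => _ /eqP eM _.
by rewrite mulrCA -exprD level_sum_cat eM /= addn0 addnC.
Qed.

Lemma genfun_excursion d k : genfun (excursion_weight d k) =
  \prod_(k <= i < k + d) (fpsX * fpsC (q ^+ (i + i.+1)) * gap_gf i i ^+ 2)
  * gap_gf (k + d) (k + d).
Proof.
elim: d k => [|d IHd] k; first by rewrite addn0 big_geq // mul1r.
rewrite /= !(genfun_conv, genfun_wrap) IHd -/(gap_gf k k) addSnnS.
rewrite [in RHS]big_ltn; last by rewrite addnS ltnS leq_addr.
by ring.
Qed.

End WordSums.

(** * Summation over heights, vanishing [p], and convergence *)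

Lemma fpsCM (R : comNzRingType) (x z : R) : fpsC (x * z) = fpsC x * fpsC z.
Proof. by apply: fpsP => n; rewrite fpscoefCM; case: n => //= n; rewrite mulr0. Qed.

Lemma fpsCX (R : comNzRingType) (x : R) n : fpsC (x ^+ n) = fpsC x ^+ n.
Proof. by elim: n => // n IHn; rewrite !exprS fpsCM IHn. Qed.

Lemma GN_sum (R : comNzRingType) (N : nat) (y p q : R) : GN N y p q =
  \sum_(0 <= h < N.+1) fpsX ^+ h * fpsC (y ^+ h * q ^+ (h ^ 2)) *
    (\prod_(0 <= i < h) gap_gf p q i i ^+ 2 * gap_gf p q h h).
Proof.
(* The enclosing steps at level [i] contribute [q] to the power [2 i + 1]; these odd numbers add up
   to [h ^ 2]. *)
have E h : fpsX ^+ h * fpsC (y ^+ h * q ^+ (h ^ 2)) *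
      (\prod_(0 <= i < h) gap_gf p q i i ^+ 2 * gap_gf p q h h)
    = fpsC (y ^+ h) * genfun (excursion_weight p q h 0).
  rewrite genfun_excursion add0n fpsCM !mulrA; congr (_ * _).
  rewrite -!mulrA mulrCA; congr (_ * _).
  elim: h => [|h IHh]; first by rewrite !big_geq // !mulr1.
  rewrite !big_nat_recr //= -IHh exprS.
  have -> : (h.+1 ^ 2 = h ^ 2 + (h + h.+1))%N by lia.
  by rewrite exprD fpsCM; ring.
under eq_bigr do rewrite E.
apply: fpsP => n; rewrite fpscoef_sum big_mkord.
under eq_bigr do rewrite fpscoefCM.
rewrite /= /word_sum; under [RHS]eq_bigr do rewrite mulr_sumr.
(* For a fixed Dyck path only the term [h = height s] can survive, and it is present exactly when
   the height is at most [N]. *)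
rewrite exchange_big big_mkcond; apply: eq_bigr => s _ /=.
under eq_bigr do rewrite dyck_excursion_weight.
case ds: (dyck s) => /=; last by rewrite big1 // => i _; rewrite mulr0.
case: leqP => [leN|ltN].
  rewrite (bigD1 (Ordinal (leN : (height s < N.+1)%N))) //= eqxx big1 ?addr0.
    by rewrite /dyck_weight mulrA.
  by move=> i; rewrite -val_eqE eq_sym /= => /negPf ->; rewrite mulr0.
rewrite big1 // => i _; rewrite gtn_eqF ?mulr0 //.
exact: leq_trans (ltn_ord i) ltN.
Qed.

Lemma GN_sum1 (R : comNzRingType) (N : nat) (y p q : R) : GN N y p q =
  1 + \sum_(1 <= h < N.+1) fpsX ^+ h * fpsC (y ^+ h * q ^+ (h ^ 2)) *
    (\prod_(0 <= i < h) gap_gf p q i i ^+ 2 * gap_gf p q h h).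
Proof.
rewrite GN_sum big_ltn //; congr (_ + _).
by rewrite gap_gf0 big_geq // !mulr1.
Qed.

(** For [r < k] the partial numerator carries a positive power of [p], so it vanishes. *)
Lemma gap_gf_p0 (R : comNzRingType) (q : R) k r : (r <= k)%N -> gap_gf 0 q k r = 1.
Proof.
case: r => [|r] ltrk; first exact: gap_gf0.
have E : (k - r.+1 + (k - r) == 0)%N = false by apply/eqP; lia.
rewrite gap_gf_rec expr0n E mul0r (_ : fpsC 0 = 0) ?mul0r ?addr0 //.
by apply: fpsP => -[].
Qed.

Lemma height_le_size s : (height s <= size s)%N.
Proof.
apply/bigmax_leqP => i _; apply: leq_trans (leq_subr _ _) _.
by apply: leq_trans (count_size _ _) _; rewrite size_take_min geq_minr.
Qed.

Lemma fps_cvg_GN (R : comNzRingType) (y p q : R) :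
  fps_cvg (fun N => GN N y p q) (G y p q).
Proof.
(* A height never exceeds the number of steps, here [2 * n]. *)
move=> n; exists (2 * n)%N => N leN; apply: eq_bigl => s /=.
case: (dyck s) => //=; apply: leq_trans leN.
by rewrite (leq_trans (height_le_size s)) ?size_tuple.
Qed.

(** * Continued fractions and the polynomials P_h *)

Section PpolyTheory.
Variable S : comNzRingType.
Implicit Types X Q : S.

Lemma gauss_bin_small (N m : nat) Q : (N < m)%N -> gauss_bin N m Q = 0.
Proof.
elim: N m => [|N IHN] [|m] //= ltNm.
by rewrite !IHN ?mulr0 ?addr0 // ltnW.
Qed.

(** For [m] beyond half of [h], [h - m < m] and the Gaussian binomial vanishes. This lets sums for
    different [h] share a range. *)
Lemma Ppoly_widen (h K : nat) X Q : (h./2 < K)%N ->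
  Ppoly h X Q =
    \sum_(m < K) (- X) ^+ m * Q ^+ (m * (m - 1)) * gauss_bin (h - m) m Q.
Proof.
move=> ltK; rewrite /Ppoly.
rewrite (big_ord_widen K (fun m => (- X) ^+ m * Q ^+ (m * (m - 1))
                                    * gauss_bin (h - m) m Q)) //.
rewrite big_mkcond; apply: eq_bigr => m _; case: ifPn => // ltm.
by rewrite gauss_bin_small ?mulr0 //; move: ltm; lia.
Qed.

Lemma Ppoly0 X Q : Ppoly 0 X Q = 1.
Proof. by rewrite /Ppoly big_ord1 /= !mulr1. Qed.

Lemma Ppoly1 X Q : Ppoly 1 X Q = 1.
Proof. by rewrite /Ppoly big_ord1 /= !mulr1. Qed.

(** The q-Pascal rule splits term [m.+1] on the left into term [m.+1] of [Ppoly h.+1] and term [m]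
    of [Ppoly h]. *)
Lemma Ppoly_rec (h : nat) X Q :
  Ppoly h.+2 X Q = Ppoly h.+1 (X * Q) Q - X * Ppoly h (X * Q * Q) Q.
Proof.
rewrite (@Ppoly_widen h.+2 h.+2) ?(@Ppoly_widen h.+1 h.+2) ?(@Ppoly_widen h h.+1);
  try lia.
rewrite big_ord_recl [in RHS]big_ord_recl -addrA; congr (_ + _).
rewrite mulr_sumr -sumrB; apply: eq_bigr => -[m /= ltm] _.
rewrite /bump /= add1n !subSS subSn //= subn0.
have -> : (m.+1 * m = m + m + m * (m - 1))%N by case: m {ltm} => // m; lia.
rewrite !exprS -!mulNr !exprMn !exprD; ring.
Qed.

End PpolyTheory.

Section ContinuedFraction.
Variables (R : comUnitRingType) (p q : R).
Hypothesis q_unit : q \is a GRing.unit.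
Implicit Types r : nat.

Let Q : fps R := fpsC (p ^+ 2 / q ^+ 2).
(** For [r] positive and at most [k] this is a partial numerator of the continued fraction. The
    exponent of [q] is an integer since it is [-1] at [r = 0]. *)
Let T k r : fps R :=
  fpsC (q ^ ((2 * r)%:Z - 1) * p ^+ (k - r + (k - r)).+1) * fpsX.

Lemma gap_weight_exponent k r : (r < k)%N ->
  fpsC (p ^+ (k - r.+1 + (k - r)) * q ^+ (r.+1 + r)) * fpsX = T k r.+1.
Proof.
move=> ltrk; rewrite /T mulrC [in RHS]mulrC; congr (_ * fpsC _).
have -> : (2 * r.+1)%:Z - 1 = (r.+1 + r)%N by lia.
by rewrite -exprnP mulrC; congr (_ * p ^+ _); lia.
Qed.

Lemma T_shift k r : (r < k)%N -> T k r.+1 * Q = T k r.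
Proof.
move=> ltrk; rewrite /T /Q mulrAC -fpsCM; congr (fpsC _ * _).
have -> : (2 * r.+1)%:Z - 1 = ((2 * r)%:Z - 1) + 2%:Z by lia.
rewrite exprzDr // -exprnP.
have -> : (k - r + (k - r)).+1 = ((k - r.+1 + (k - r.+1)).+1 + 2)%N by lia.
set u := q ^ _; set a := (k - r.+1 + _)%N.
transitivity (q ^+ 2 / q ^+ 2 * (u * p ^+ (a.+1 + 2))); last first.
  by rewrite divrr ?unitrX ?mul1r.
by rewrite exprD; ring.
Qed.

(** With [T_shift], [Ppoly_rec] rewrites the denominator at [r.+1] through the two polynomials at
    [r]; the induction hypothesis then exposes the factor [1 - T k r.+1 * gap_gf p q k r], the
    inverse of [F]. *)
Lemma gap_gf_Ppoly k r : (r <= k)%N ->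
  gap_gf p q k r * Ppoly r.+1 (T k r) Q = Ppoly r (T k r * Q) Q.
Proof.
elim: r => [|r IHr] ltrk; first by rewrite gap_gf0 Ppoly0 Ppoly1 mulr1.
set F := gap_gf p q k r.+1.
have EF : F * (1 - T k r.+1 * gap_gf p q k r) = 1.
  have := gap_gf_rec p q k r; rewrite -/F gap_weight_exponent // => EF.
  by rewrite mulrBr mulr1 [F * _]mulrC {1}EF addrK.
rewrite Ppoly_rec T_shift // -IHr 1?ltnW //.
rewrite -[RHS]mul1r -EF; ring.
Qed.

Lemma gap_gfE k : gap_gf p q k k =
  Ppoly k (fpsC (q ^ ((2 * k)%:Z - 3) * p ^+ 3) * fpsX) Q
  / Ppoly k.+1 (fpsC (q ^ ((2 * k)%:Z - 1) * p) * fpsX) Q.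
Proof.
apply: canRL (mulrK (Ppoly_unit _ _ _)) _.
have ET : T k k = fpsC (q ^ ((2 * k)%:Z - 1) * p) * fpsX.
  by rewrite /T subnn expr1.
have := gap_gf_Ppoly (leqnn k); rewrite ET => ->; congr (Ppoly k _ Q).
rewrite mulrAC -fpsCM; congr (fpsC _ * _).
have -> : (2 * k)%:Z - 1 = ((2 * k)%:Z - 3) + 2%:Z by lia.
rewrite exprzDr // -exprnP; set u := q ^ _.
transitivity (q ^+ 2 / q ^+ 2 * (u * p ^+ 3)); last by rewrite divrr ?unitrX ?mul1r.
by ring.
Qed.

End ContinuedFraction.

(** Moving the range of the [a k] from [1], ..., [h] to [0], ..., [h - 1] costs [a h ^+ 2], as
    [a 0 = 1]; dividing by [a h] leaves the single factor needed in front. *)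
Lemma prod_ratio_shift (S : comUnitRingType) (a b : nat -> S) h :
    a 0%N = 1 -> b 0%N = 1 -> a h \is a GRing.unit -> b h \is a GRing.unit ->
  \prod_(1 <= k < h.+1) (a k ^+ 2 / b k.-1 ^+ 2) / (a h * b h)
    = \prod_(0 <= k < h) (a k / b k) ^+ 2 * (a h / b h).
Proof.
move=> a0 b0 ua ub.
have -> : \prod_(1 <= k < h.+1) (a k ^+ 2 / b k.-1 ^+ 2)
        = a h ^+ 2 * \prod_(0 <= k < h) (a k / b k) ^+ 2.
  elim: h {ua ub} => [|h IHh]; first by rewrite !big_geq // a0 mulr1 expr1n.
  by rewrite big_nat_recr //= IHh big_nat_recr //= exprMn exprVn; ring.
rewrite invrM //; transitivity (a h / a h *
    (\prod_(0 <= k < h) (a k / b k) ^+ 2 * (a h / b h))); first by ring.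
by rewrite divrr ?mul1r.
Qed.

Theorem proposition4p2 (R : comUnitRingType) (y p q : R) :
  [/\ q \is a GRing.unit -> forall N : nat,
        GN N y p q =
          \sum_(0 <= h < N.+1)
            fpsX ^+ h * fpsC (y ^+ h * q ^+ (h ^ 2)) *
            (\prod_(1 <= k < h.+1)
               (Ppoly k (fpsC (q ^ ((2 * k)%:Z - 3) * p ^+ 3) * fpsX)
                        (fpsC (p ^+ 2 / q ^+ 2)) ^+ 2 /
                Ppoly k (fpsC (q ^ ((2 * k)%:Z - 3) * p) * fpsX)
                        (fpsC (p ^+ 2 / q ^+ 2)) ^+ 2)) /
            (Ppoly h (fpsC (q ^ ((2 * h)%:Z - 3) * p ^+ 3) * fpsX)
                     (fpsC (p ^+ 2 / q ^+ 2)) *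
             Ppoly h.+1 (fpsC (q ^ ((2 * h)%:Z - 1) * p) * fpsX)
                        (fpsC (p ^+ 2 / q ^+ 2))),
      forall N : nat, GN N y p 0 = 1,
      forall N : nat,
        GN N y 0 q =
          1 + \sum_(1 <= h < N.+1) (fpsX * fpsC y) ^+ h * fpsC (q ^+ (h ^ 2))
    & fps_cvg (fun N => GN N y p q) (G y p q)].
Proof.
split.
- move=> q_unit N; rewrite GN_sum; apply: eq_big_nat => h _.
  rewrite -[RHS]mulrA; congr (_ * _).
  rewrite gap_gfE //; under eq_bigr do rewrite gap_gfE //.
  pose Q : fps R := fpsC (p ^+ 2 / q ^+ 2).
  pose a k := Ppoly k (fpsC (q ^ ((2 * k)%:Z - 3) * p ^+ 3) * fpsX) Q.
  pose b k := Ppoly k.+1 (fpsC (q ^ ((2 * k)%:Z - 1) * p) * fpsX) Q.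
  rewrite -(@prod_ratio_shift _ a b) ?Ppoly_unit ?/a ?/b ?Ppoly0 ?Ppoly1 //.
  apply: (congr1 (fun u => u / _)); apply: eq_big_nat => -[|k] ltk; first by [].
  (* The denominator at index [k.+1] is [b k], since [2 (k + 1) - 3 = 2 k - 1]. *)
  rewrite [k.+1.-1]/=; have -> : (2 * k.+1)%:Z - 3 = (2 * k)%:Z - 1 by lia.
  by [].
- move=> N; rewrite GN_sum1 big_nat big1 ?addr0 // => h /andP[h_gt0 _].
  rewrite expr0n expn_eq0 eqn0Ngt h_gt0 /= mulr0.
  by rewrite (_ : fpsC 0 = 0) ?mulr0 ?mul0r //; apply: fpsP => -[].
- move=> N; rewrite GN_sum1; congr (_ + _); apply: eq_bigr => h _.
  under eq_bigr do rewrite gap_gf_p0 // expr1n.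
  by rewrite gap_gf_p0 // big1_eq !mulr1 fpsCM fpsCX exprMn mulrA.
- exact: fps_cvg_GN.
Qed.
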